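(* Let $(\Omega,\Pi,t)$ be a single player information structure. If a probability distribution $p\in\Delta(\Omega)$ is $(\Pi,t)$-disintegrable, then it is $(\Pi,t)$-conglomerable.
   Context: $\Omega$ is a finite nonempty set and $\Delta(\Omega)$ is the set of probability measures on $\Omega$ (all subsets measurable). A single player information structure is a tuple $(\Omega,\Pi,t)$ where $\Pi$ is a partition of $\Omega$ and $t\colon\Omega\to\Delta(\Omega)$ is a function such that $t(\omega)(\pi(\omega))=1$ for every $\omega\in\Omega$, where $\pi(\omega)$ is the element of $\Pi$ containing $\omega$, and $t$ is constant on each element of $\Pi$. A distribution $p\in\Delta(\Omega)$ is $(\Pi,t)$-disintegrable if $p(E\cap\pi)=t(\omega)(E)\,p(\pi)$ for every $E\subseteq\Omega$, every $\pi\in\Pi$ and all $\omega\in\pi$. It is $(\Pi,t)$-conglomerable if $\min_{\omega\in\Omega}t(\omega)(E)\le p(E)\le\max_{\omega\in\Omega}t(\omega)(E)$ for each $E\subseteq\Omega$. *)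

(* Defs.v *)
From HB Require Import structures.
From mathcomp Require Import all_boot all_order all_algebra.
From mathcomp Require Import all_classical all_reals all_analysis.

Set Implicit Arguments.
Unset Strict Implicit.
Unset Printing Implicit Defensive.

Local Open Scope classical_set_scope.
Local Open Scope ereal_scope.

(* Finite nonempty sets: the distinguished point records nonemptiness and is
   what [measurableType] requires.  Nothing below depends on which point it is. *)
#[short(type="finPointedType")]
HB.structure Definition FinPointed := {T of Finite T & isPointed T}.

(* [discrete Omega] is [Omega] with every subset measurable. *)
Definition discrete (Omega : Type) : Type := Omega.

HB.instance Definition _ (Omega : finPointedType) :=
  FinPointed.on (discrete Omega).
HB.instance Definition _ (Omega : finPointedType) :=
  @isMeasurable.Build default_measure_display (discrete Omega)
    discrete_measurable discrete_measurable0
    discrete_measurableC discrete_measurableU.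

Notation Delta Omega R := (probability (discrete Omega) R).

Section InformationStructures.
Context (R : realType) (Omega : finPointedType).

(* For a partition [Pi], [pblock Pi id w] is the element of [Pi] containing
   [w]. *)
Record single_player_info_structure
    (Pi : set (set Omega)) (t : Omega -> Delta Omega R) : Prop := {
  info_partition : partition Pi id [set: Omega];
  info_support : forall w : Omega, t w (pblock Pi id w) = 1;
  info_constant : forall B : set Omega, Pi B ->
    forall w w' : Omega, B w -> B w' -> t w = t w'
}.

Definition disintegrable (Pi : set (set Omega)) (t : Omega -> Delta Omega R)
    (p : Delta Omega R) : Prop :=
  forall (E B : set Omega), Pi B ->
    forall w : Omega, B w -> p (E `&` B) = t w E * p B.

(* The neutral elements +oo and -oo are immaterial: [Omega] is nonempty, so
   these are the minimum and the maximum of [t w E] over [w].  The partition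
   is part of the terminology, although the condition does not involve it. *)
Definition conglomerable (Pi : set (set Omega)) (t : Omega -> Delta Omega R)
    (p : Delta Omega R) : Prop :=
  forall E : set Omega,
    \big[Order.min/+oo]_(w : Omega) t w E <= p E
    /\ p E <= \big[Order.max/-oo]_(w : Omega) t w E.

End InformationStructures.

(* Main.v *)
(* Summing the disintegration identity over the cells B of Pi exhibits p(E) as
   the average of the values t(B)(E) with weights p(B), which sum to 1. *)
Require Import Defs.
From mathcomp Require Import all_boot all_order all_algebra.
From mathcomp Require Import all_classical all_reals all_analysis.
Import Order.TTheory.

Local Open Scope classical_set_scope.
Local Open Scope ereal_scope.

(** An average lies between its extremes: the minimum and maximum of [t w E] are averages of
    themselves with the same weights [p B], so the bounds follow cell by cell. [measure_partitionE]
    serves for both [E] and [setT]. *)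

Lemma finite_set_family (T : finType) (F : set (set T)) : finite_set F.
Proof.
(* Every subset of [T] is coded by an element of the finite type [{set T}]. *)
apply: (@sub_finite_set _ _ ((fun A : {set T} => [set` A]) @` [set: {set T}])).
  move=> B _; exists [set x | `[< B x >]]%SET => //.
  by apply/seteqP; split => x /=; rewrite finset.inE => /asboolP.
exact/finite_image/finite_finset.
Qed.

Lemma measure_partitionE (R : realType) (Omega : finPointedType)
    (Pi : set (set Omega)) (p : Delta Omega R) (E : set Omega) :
  classical_sets.partition Pi id [set: Omega] ->
  p E = \sum_(B \in Pi) p (E `&` B).
Proof.
move=> [coverPi trivPi _].
rewrite -measure_fin_bigcup//; first last.
- exact: trivIset_setIl.
- exact: finite_set_family.
- by rewrite -setI_bigcupr -/(cover Pi id) coverPi setIT.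
Qed.

Theorem proposition7 (R : realType) (Omega : finPointedType)
    (Pi : set (set Omega)) (t : Omega -> Delta Omega R)
    (hI : single_player_info_structure Pi t)
    (p : Delta Omega R) (hp : disintegrable Pi t p) :
  conglomerable Pi t p.
Proof.
move=> E.
have partPi := info_partition hI.
have Pi0 B : Pi B -> exists w, B w by move=> PiB; have [_ _] := partPi; exact.
(* The weights sum to [p setT = 1]; being nonnegative, they let any extended real [x] distribute
   over the sum. *)
have weighted_cells x : x = \sum_(B \in Pi) x * p B.
  rewrite -ge0_mule_fsumr// -[LHS]mule1 -(@probability_setT _ _ _ p).
  rewrite (@measure_partitionE _ _ _ p setT partPi).
  by under eq_fsbigr do rewrite setTI.
rewrite (@measure_partitionE _ _ _ p E partPi); split.
- rewrite [leLHS]weighted_cells; apply: lee_fsum => [|B PiB].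
    exact: finite_set_family.
  (* A point of the cell turns [p (E]&[B)] into [t w E * p B]. *)
  have [w Bw] := Pi0 B PiB.
  by rewrite (hp E B PiB w Bw) lee_wpmul2r//; apply: bigmin_le.
- rewrite [leRHS]weighted_cells; apply: lee_fsum => [|B PiB].
    exact: finite_set_family.
  have [w Bw] := Pi0 B PiB.
  by rewrite (hp E B PiB w Bw) lee_wpmul2r//;
    apply: (le_bigmax _ (fun w => t w E)).
Qed.
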